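(* Let $\mathcal{A}$ be a weighted automaton satisfying the standing assumptions in the context. If $\mathcal{A}$ is unambiguisable then $\mathcal{A}$ is pumpable, and if $\mathcal{A}$ is determinisable then $\mathcal{A}$ is blindly pumpable.
   Context: A weighted automaton (over $\mathbb{Q}$) is a tuple $\mathcal{A}=(Q,\Sigma,M,I,F)$ with $Q$ a finite nonempty set of states, $\Sigma$ a finite alphabet, $M:\Sigma\to\mathbb{Q}^{Q\times Q}$, and $I,F\in\mathbb{Q}^Q$. For $w=a_1\cdots a_n$ put $M(w)=M(a_1)\cdots M(a_n)$, with $M(\epsilon)$ the identity matrix, and $\mathcal{A}(w)=I^T M(w) F$. The size $|\mathcal{A}|$ is the number $|Q|$ of states. Two automata over $\Sigma$ are equivalent if they give the same value to every word of $\Sigma^*$. A path on $w=a_1\cdots a_n$ is a sequence of states $q_1,\dots,q_{n+1}$ with $M(a_i)_{q_i,q_{i+1}}\neq 0$ for all $i$; it is a run if moreover $I(q_1)\neq 0$ and $F(q_{n+1})\neq 0$. $\mathcal{A}$ is deterministic if $I$ has at most one non-zero entry and, for every $a\in\Sigma$, every row of $M(a)$ has at most one non-zero entry; it is unambiguous if every word has at most one run. $\mathcal{A}$ is unambiguisable (resp. determinisable) if it is equivalent to some unambiguous (resp. deterministic) weighted automaton over $\mathbb{Q}$. Standing assumptions on $\mathcal{A}$: all entries of $I$, $F$ and $M(a)$ ($a\in\Sigma$) are integers; $M(a)_{p,q}\geq 0$ for all $a\in\Sigma$, $p,q\in Q$ (entries of $I,F$ may be negative); every state lies on some run (i.e.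 is reachable from a state $p$ with $I(p)\ne0$ and can reach a state $r$ with $F(r)\neq 0$). A square matrix $N$ is p-triangular if there is a permutation matrix $P$ with $PNP^{-1}$ upper triangular. $\mathbb{N}$ contains $0$. $\mathcal{A}$ is pumpable if for all $u,v,w\in\Sigma^*$ such that $M(v)$ is p-triangular there is a diagonal entry $d$ of $M(v)$ with $\mathcal{A}(uv^{|\mathcal{A}|+n}w)=d^n\cdot\mathcal{A}(uv^{|\mathcal{A}|}w)$ for every $n\in\mathbb{N}$. $\mathcal{A}$ is blindly pumpable if for all $u,v\in\Sigma^*$ such that $M(v)$ is p-triangular there is a diagonal entry $d$ of $M(v)$ with $\mathcal{A}(uv^{|\mathcal{A}|+n}w)=d^n\cdot\mathcal{A}(uv^{|\mathcal{A}|}w)$ for every $w\in\Sigma^*$ and $n\in\mathbb{N}$. *)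

(* Defs.v *)
From HB Require Import structures.
From mathcomp Require Import all_boot all_order all_fingroup all_algebra.

Set Implicit Arguments.
Unset Strict Implicit.
Unset Printing Implicit Defensive.

Import Order.TTheory GRing.Theory Num.Theory.
Local Open Scope ring_scope.

(* The finite nonempty state set is taken to be {0, ..., wa_size - 1}. *)
Record wautomaton (Sigma : finType) := WAutomaton {
  wa_size : nat;
  wa_size_gt0 : (0 < wa_size)%N;
  wa_mx : Sigma -> 'M[rat]_wa_size;
  wa_init : 'cV[rat]_wa_size;
  wa_final : 'cV[rat]_wa_size
}.

Section WeightedAutomata.
Variable Sigma : finType.
Implicit Types (A B : wautomaton Sigma) (w : seq Sigma).

Definition wa_wordmx A w : 'M[rat]_(wa_size A) := \prod_(a <- w) wa_mx A a.

Definition wa_val A w : rat :=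
  ((wa_init A)^T *m wa_wordmx A w *m wa_final A) 0 0.

Definition equivalent A B := forall w, wa_val A w = wa_val B w.

(* rho lists all the states visited, so it has size w + 1 elements. *)
Fixpoint is_path A w (rho : seq 'I_(wa_size A)) {struct w} : bool :=
  match w, rho with
  | [::], [:: _] => true
  | a :: w', p :: (q :: _) as rho' => (wa_mx A a p q != 0) && is_path w' rho'
  | _, _ => false
  end.

Definition is_run A w (rho : seq 'I_(wa_size A)) : bool :=
  if rho is p :: s then
    [&& is_path w rho, wa_init A p 0 != 0 & wa_final A (last p s) 0 != 0]
  else false.

Definition deterministic A :=
  (forall p q, wa_init A p 0 != 0 -> wa_init A q 0 != 0 -> p = q) /\
  (forall a p q r,
     wa_mx A a p q != 0 -> wa_mx A a p r != 0 -> q = r).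

Definition unambiguous A :=
  forall w (rho rho' : seq 'I_(wa_size A)),
    is_run w rho -> is_run w rho' -> rho = rho'.

Definition unambiguisable A := exists B, equivalent A B /\ unambiguous B.

Definition determinisable A := exists B, equivalent A B /\ deterministic B.

Definition integral A :=
  [/\ forall q, wa_init A q 0 \is a Num.int,
      forall q, wa_final A q 0 \is a Num.int
    & forall a p q, wa_mx A a p q \is a Num.int].

Definition nonneg_transitions A := forall a p q, 0 <= wa_mx A a p q.

Definition trim A :=
  forall q : 'I_(wa_size A), exists w rho, is_run w rho /\ q \in rho.

(* is_trig_mx means lower triangular, hence the transpose. *)
Definition p_triangular n (N : 'M[rat]_n) :=
  exists P : 'M[rat]_n, is_perm_mx P /\ is_trig_mx (P *m N *m invmx P)^T.

Definition word_exp w n : seq Sigma := flatten (nseq n w).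

Definition pumpable A :=
  forall u v w, p_triangular (wa_wordmx A v) ->
  exists q : 'I_(wa_size A), forall n : nat,
    wa_val A (u ++ word_exp v (wa_size A + n)%N ++ w) =
    wa_wordmx A v q q ^+ n * wa_val A (u ++ word_exp v (wa_size A) ++ w).

Definition blindly_pumpable A :=
  forall u v, p_triangular (wa_wordmx A v) ->
  exists q : 'I_(wa_size A), forall w (n : nat),
    wa_val A (u ++ word_exp v (wa_size A + n)%N ++ w) =
    wa_wordmx A v q q ^+ n * wa_val A (u ++ word_exp v (wa_size A) ++ w).

End WeightedAutomata.

(* Main.v *)
(* Fix u, v, w and put f(n) = A(u v^n w). By Cayley-Hamilton f satisfies the
   linear recurrence whose characteristic roots are the diagonal entries of
   M(v), which are nonnegative reals, so a discrete Rolle argument shows that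
   every sequence satisfying it has eventually constant sign; hence, if it
   vanishes on an arithmetic progression, it vanishes from index |A| on.
   If f is computed by an unambiguous automaton, pumping a loop of the unique
   run gives f(m + (k+1) l) = c f(m + k l) for some c <> 0; applying the above
   to f(n + l) - c f(n) yields f(n + l) = c f(n) for all n >= |A|. As at most
   one nonnegative root d satisfies d^l = c, this forces f(n + 1) = d f(n).
   For a deterministic automaton the loop, hence l, c and d, does not depend
   on w. *)

Require Import Defs.
From mathcomp Require Import all_boot all_order all_fingroup all_algebra.
From mathcomp Require Import ring.
From Stdlib Require Import Classical_Prop.

Set Implicit Arguments.
Unset Strict Implicit.
Unset Printing Implicit Defensive.

Import Order.TTheory GRing.Theory Num.Theory.
Local Open Scope ring_scope.

(** * Linear recurrences with nonnegative characteristic roots *)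

Section LinearRecurrences.
Variable R : realFieldType.
Implicit Types (d c : R) (ds : seq R) (g : nat -> R).

Definition shift_sub d g : nat -> R := fun n => g n.+1 - d * g n.

(** With E the shift operator, this says that the product of the E - d, for d in [ds], kills [g].
    Applying the factors one at a time makes induction on the roots available. *)
Fixpoint annihilated ds g : Prop :=
  if ds is d :: ds' then annihilated ds' (shift_sub d g)
  else forall n, g n = 0.

Lemma eq_annihilated ds g h : g =1 h -> annihilated ds g -> annihilated ds h.
Proof.
elim: ds g h => [|d ds IH] g h gh /=; first by move=> g0 n; rewrite -gh.
by apply: IH => n; rewrite /shift_sub !gh.
Qed.

(** The operators E^l - c and E - d commute. *)
Lemma annihilated_shift ds g l c :
  annihilated ds g -> annihilated ds (fun n => g (n + l)%N - c * g n).
Proof.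
elim: ds g => [|d ds IH] g /=; first by move=> g0 n; rewrite !g0; ring.
move=> /IH; apply: eq_annihilated => n.
by rewrite /shift_sub addSn; ring.
Qed.

Lemma shift_sub0 d g m k : (forall n, (m <= n)%N -> shift_sub d g n = 0) ->
  g (m + k)%N = d ^+ k * g m.
Proof.
move=> F0; elim: k => [|k IH]; first by rewrite addn0 expr0 mul1r.
have /eqP := F0 (m + k)%N (leq_addr _ _).
by rewrite /shift_sub subr_eq0 addnS IH exprS mulrA => /eqP.
Qed.

(* A discrete form of Rolle's theorem: [g] can cross zero only finitely often
   if [shift_sub d g] does. *)
Lemma shift_sub_eventual_gt0 d g N : 0 <= d ->
    (forall n, (N <= n)%N -> 0 < shift_sub d g n) ->
  exists N' s, forall n, (N' <= n)%N -> Num.sg (g n) = s.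
Proof.
move=> d0 Fpos.
have [[n0 [Nn0 gn0]]|noge] := classic (exists n, (N <= n)%N /\ 0 <= g n).
  have gpos k : 0 < g (n0 + k).+1.
    elim: k => [|k IH].
      have := Fpos n0 Nn0; rewrite /shift_sub addn0 subr_gt0.
      by apply: le_lt_trans; rewrite mulr_ge0.
    have Nk : (N <= (n0 + k).+1)%N by rewrite (leq_trans Nn0) // leqW // leq_addr.
    have := Fpos _ Nk; rewrite /shift_sub addnS subr_gt0.
    by apply: le_lt_trans; rewrite mulr_ge0 // ltW.
  exists n0.+1, 1 => -[|n] // n0n.
  by apply: gtr0_sg; rewrite -(subnKC n0n) addSn gpos.
exists N, (-1) => n Nn; apply: ltr0_sg; rewrite ltNge; apply/negP => gn.
by apply: noge; exists n.
Qed.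

(** Induction on the roots. If [shift_sub d g] is eventually nonzero, the Rolle argument applies to
    [g] or to its opposite; if it is eventually zero, [g] is eventually geometric of ratio
    [d >= 0]. *)
Lemma annihilated_eventual_sg ds g :
    (forall d, d \in ds -> 0 <= d) -> annihilated ds g ->
  exists N s, forall n, (N <= n)%N -> Num.sg (g n) = s.
Proof.
elim: ds g => [|d ds IH] g ds0 /=.
  by move=> g0; exists 0%N, 0 => n _; rewrite g0 sgr0.
have d0 : 0 <= d by rewrite ds0 ?mem_head.
have ds'0 e : e \in ds -> 0 <= e by move=> eds; rewrite ds0 // in_cons eds orbT.
move=> /(IH _ ds'0) [N [s Fs]].
have [F0|F0|F0] := ltrgtP (shift_sub d g N) 0.
- have sN1 : s = -1 by rewrite -(Fs N) // ltr0_sg.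
  have [||N' [s' gs']] := @shift_sub_eventual_gt0 d (fun n => - g n) N => //.
    move=> n /Fs; rewrite sN1 => /eqP; rewrite sgr_cp0 -oppr_gt0.
    by rewrite /shift_sub mulrN opprB opprK addrC.
  by exists N', (- s') => n /gs' <-; rewrite sgrN opprK.
- have s1 : s = 1 by rewrite -(Fs N) // gtr0_sg.
  apply: (@shift_sub_eventual_gt0 d g N) => // n /Fs.
  by rewrite s1 => /eqP; rewrite sgr_cp0.
have s0 : s = 0 by rewrite -(Fs N) // F0 sgr0.
have gN k : g (N + k)%N = d ^+ k * g N.
  apply: shift_sub0 => n /Fs; rewrite s0 => /eqP.
  by rewrite sgr_eq0 => /eqP.
have [d_eq0|d_neq0] := eqVneq d 0.
  (* Since [0 ^+ 0 = 1], the term at [N] itself may be nonzero; vanishing starts one index later. *)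
  exists N.+1, 0 => n Nn; rewrite -(subnKC Nn) addSnnS gN d_eq0 expr0n mul0r.
  exact: sgr0.
exists N, (Num.sg (g N)) => n Nn.
by rewrite -(subnKC Nn) gN sgrM gtr0_sg ?mul1r // exprn_gt0 // lt0r d_neq0.
Qed.

(** Each root delays vanishing by at most one index: a zero root is a pure shift, and for a nonzero
    root a vanishing term far away is carried back by dividing by a power of [d]. The bound thus
    drops from an arbitrary [N] to the number of roots. *)
Lemma annihilated_eventually0 ds g N : annihilated ds g ->
    (forall n, (N <= n)%N -> g n = 0) ->
  forall n, (size ds <= n)%N -> g n = 0.
Proof.
elim: ds g => [|d ds IH] g /=; first by move=> g0 _ n _.
move=> /IH F0 g0.
have {}F0 n : (size ds <= n)%N -> shift_sub d g n = 0.
  by apply: F0 => m Nm; rewrite /shift_sub !g0 ?mulr0 ?subr0 // leqW.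
have [d_eq0|d_neq0] := eqVneq d 0; move=> [//|n] dsn.
  by have /eqP := F0 n dsn; rewrite /shift_sub d_eq0 mul0r subr0 => /eqP.
have /(@shift_sub0 d g n.+1 N) : forall m, (n < m)%N -> shift_sub d g m = 0.
  by move=> m nm; rewrite F0 // (leq_trans _ nm) // leqW.
rewrite g0 ?leq_addl // => /esym/eqP.
by rewrite mulf_eq0 expf_eq0 (negPf d_neq0) andbF => /eqP.
Qed.

(** The progression meets the range where the sign is constant, so that sign is 0. *)
Lemma annihilated_progression0 ds g m l :
    (forall d, d \in ds -> 0 <= d) -> annihilated ds g -> (0 < l)%N ->
    (forall k, g (m + k * l)%N = 0) ->
  forall n, (size ds <= n)%N -> g n = 0.
Proof.
move=> ds0 dsg l0 g0.
have [N [s gs]] := annihilated_eventual_sg ds0 dsg.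
apply: (@annihilated_eventually0 _ _ N) => // n Nn; apply/eqP.
have Nml : (N <= m + N * l)%N by rewrite (leq_trans (leq_pmulr N l0)) ?leq_addl.
by rewrite -sgr_eq0 gs // -(gs _ Nml) g0 sgr0.
Qed.

(* [S] is the sum of [d ^+ (l - i) * e ^+ i] for [i <= l]. *)
Lemma shift_sub_geometric d e g m l : 0 <= d -> 0 < e ->
    (forall n, (m <= n)%N -> shift_sub d g n.+1 = e * shift_sub d g n) ->
  exists2 S, 0 < S &
    forall n, (m <= n)%N -> g (n + l.+1)%N = d ^+ l.+1 * g n + S * shift_sub d g n.
Proof.
move=> d0 e0 eF.
have eF' k n : (m <= n)%N -> shift_sub d g (n + k)%N = e ^+ k * shift_sub d g n.
  move=> mn; elim: k => [|k IH]; first by rewrite addn0 expr0 mul1r.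
  by rewrite addnS eF ?IH ?exprS ?mulrA // (leq_trans mn) ?leq_addr.
have gS n : g n.+1 = d * g n + shift_sub d g n by rewrite /shift_sub; ring.
elim: l => [|l [S S0 IH]].
  by exists 1 => // n mn; rewrite addn1 gS expr1 mul1r.
exists (d * S + e ^+ l.+1).
  by rewrite ltr_wpDl ?exprn_gt0 // mulr_ge0 // ltW.
move=> n mn; rewrite addnS gS IH // eF' // [d ^+ l.+2]exprS; ring.
Qed.

(** Induction on the roots: F = [shift_sub d g] inherits the relation with the same [c]. If F
    vanishes from [m] on, the root is [d]. Otherwise F is geometric of some ratio [e], and comparing
    two expressions of [g (n + l)] shows that [g] is proportional to F, so [e] is the root. *)
Lemma annihilated_geometric ds g m l c :
    (forall d, d \in ds -> 0 <= d) -> annihilated ds g -> (0 < l)%N -> c != 0 ->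
    (forall n, (m <= n)%N -> g (n + l)%N = c * g n) ->
  (forall n, (m <= n)%N -> g n = 0) \/
  exists2 d, d \in ds & forall n, (m <= n)%N -> shift_sub d g n = 0.
Proof.
case: l => // l ds0 dsg _ c0; elim: ds g ds0 dsg => [|d ds IH] g ds0 /= dsg gl.
  by left=> n _.
have d0 : 0 <= d by rewrite ds0 ?mem_head.
have ds'0 e : e \in ds -> 0 <= e by move=> eds; rewrite ds0 // in_cons eds orbT.
have Fl n : (m <= n)%N -> shift_sub d g (n + l.+1)%N = c * shift_sub d g n.
  by move=> mn; rewrite /shift_sub -addSn !gl ?leqW //; ring.
have [F0|[e eds eF]] := IH _ ds'0 dsg Fl; right.
  by exists d; rewrite ?mem_head.
have {}eF n : (m <= n)%N -> shift_sub d g n.+1 = e * shift_sub d g n.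
  by move=> /eF /eqP; rewrite subr_eq0 => /eqP.
have [Fm0|Fm_neq0] := eqVneq (shift_sub d g m) 0.
  exists d; rewrite ?mem_head // => n mn; rewrite -(subnKC mn).
  elim: (n - m)%N => [|k IHk]; first by rewrite addn0.
  by rewrite addnS eF ?leq_addr // IHk mulr0.
have e0 : 0 < e.
  rewrite lt0r ds'0 // andbT; apply: contra_neq Fm_neq0 => e0.
  have := Fl m (leqnn m); rewrite addnS eF ?leq_addr // e0 mul0r => /esym/eqP.
  by rewrite mulf_eq0 (negPf c0) => /eqP.
(* Nonnegativity of the roots is used here: with [d = -e] the sum [S] could vanish, and [g] would
   mix two ratios. *)
have [S S0 gS] := shift_sub_geometric l d0 e0 eF.
have FS n : (m <= n)%N -> S * shift_sub d g n = (c - d ^+ l.+1) * g n.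
  by move=> mn; rewrite mulrBl -gl // gS //; ring.
have cd : c - d ^+ l.+1 != 0.
  apply: contra_neq Fm_neq0 => cd; have /eqP := FS m (leqnn m).
  by rewrite cd mul0r mulf_eq0 gt_eqF // => /eqP.
exists e; first by rewrite in_cons eds orbT.
move=> n mn; apply: (mulfI cd).
rewrite mulr0 {1}/shift_sub mulrBr mulrCA -!FS ?leqW // eF //; ring.
Qed.

(** The sequence [g (n + l) - c * g n] has the same roots and vanishes on a progression, hence from
    [size ds] on; the previous lemma then extracts a single root. *)
Lemma annihilated_progression ds g m l c :
    (forall d, d \in ds -> 0 <= d) -> annihilated ds g -> (0 < l)%N -> c != 0 ->
    (forall k, g (m + k.+1 * l)%N = c * g (m + k * l)%N) ->
  (forall n, (size ds <= n)%N -> g n = 0) \/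
  exists d, [/\ d \in ds, d ^+ l = c &
    forall n, g (size ds + n)%N = d ^+ n * g (size ds)].
Proof.
move=> ds0 dsg l0 c0 gl.
have {}gl n : (size ds <= n)%N -> g (n + l)%N = c * g n.
  move=> dsn; apply/eqP; rewrite -subr_eq0; apply/eqP; move: n dsn.
  apply: (@annihilated_progression0 _ _ m _ ds0 (annihilated_shift l c dsg) l0) => k.
  by rewrite -addnA -mulSnr gl subrr.
have [g0|[d dds F0]] := annihilated_geometric ds0 dsg l0 c0 gl; first by left.
have gd n := shift_sub0 n F0.
(* A nonzero value at [size ds] is what allows [d ^+ l = c] to be read off by cancellation. *)
have [g0|g_neq0] := eqVneq (g (size ds)) 0.
  by left=> n dsn; rewrite -(subnKC dsn) gd g0 mulr0.
right; exists d; split=> //; apply: (mulIf g_neq0).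
by rewrite -gd gl.
Qed.

End LinearRecurrences.

(** * Powers of p-triangular matrices as linear recurrences *)

Section PTriangular.

(** Applying E - d to the sequence amounts to replacing [y] by (N - d) y, so the factors of the
    polynomial are absorbed into [y] one by one. *)
Lemma annihilated_bilinear (F : realFieldType) n (N : 'M[F]_n.+1) (x : 'rV_n.+1)
    (y : 'cV_n.+1) (ds : seq F) :
  horner_mx N (\prod_(d <- ds) ('X - d%:P)) *m y = 0 ->
  annihilated ds (fun k => (x *m N ^+ k *m y) 0 0).
Proof.
elim: ds y => [|d ds IH] y.
  by rewrite big_nil rmorph1 mul1mx => -> n0; rewrite mulmx0 mxE.
rewrite big_cons mulrC rmorphM rmorphB /= horner_mx_X horner_mx_C.
rewrite -mulmxE -mulmxA => /IH; apply: eq_annihilated => k.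
rewrite /shift_sub mulmxBl mul_scalar_mx mulmxBr -scalemxAr.
rewrite [LHS]mxE [X in _ + X]mxE [X in _ - X]mxE.
by rewrite exprSr -mulmxE !mulmxA.
Qed.

(** Conjugation by a permutation matrix and transposition preserve the characteristic polynomial,
    and the conjugation only permutes the diagonal. *)
Lemma char_poly_p_triangular n (N : 'M[rat]_n) :
  p_triangular N -> char_poly N = \prod_(i < n) ('X - (N i i)%:P).
Proof.
case=> P [/existsP [s /eqP ->]].
have -> : invmx (perm_mx s) = perm_mx s^-1 :> 'M[rat]_n.
  have sV : perm_mx s *m perm_mx s^-1 = 1%:M :> 'M[rat]_n.
    by rewrite -perm_mxM mulgV perm_mx1.
  have sU : (perm_mx s : 'M[rat]_n) \in unitmx by rewrite unitmx_perm.
  by apply: (can_inj (mulKmx sU)); rewrite mulmxV // sV.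
rewrite -mulmxA -col_permE -row_permE => Ntrig.
transitivity (char_poly (row_perm s (col_perm s N))^T).
  rewrite /char_poly /char_poly_mx -map_trmx -(tr_scalar_mx _ 'X) -linearB det_tr /=.
  rewrite row_permE col_permE map_mxM /= map_mxM /= !map_perm_mx.
  set M := map_mx _ N.
  have -> : 'X%:M - perm_mx s *m (M *m perm_mx s^-1) =
    perm_mx s *m ('X%:M - M) *m perm_mx s^-1 :> 'M[{poly rat}]_n.
    rewrite mulmxBr mulmxBl scalar_mxC -!mulmxA -perm_mxM mulgV perm_mx1.
    by rewrite mulmx1.
  by rewrite tr_scalar_mx !det_mulmx mulrAC -det_mulmx -perm_mxM mulgV perm_mx1 det1 mul1r.
rewrite char_poly_trig // [RHS](reindex_inj (@perm_inj _ s)) /=.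
by apply: eq_bigr => i _; rewrite !mxE.
Qed.

Lemma annihilated_p_triangular n (N : 'M[rat]_n) (x : 'rV_n) (y : 'cV_n) :
  p_triangular N ->
  annihilated [seq N i i | i : 'I_n] (fun k => (x *m N ^+ k *m y) 0 0).
Proof.
case: n N x y => [|n] N x y Ntri.
  by rewrite /image_mem enum_ord0 => k; rewrite mxE big_ord0.
apply: annihilated_bilinear; rewrite big_map big_enum /=.
by rewrite -char_poly_p_triangular // Cayley_Hamilton mul0mx.
Qed.

(** The list of diagonal entries has length [n], which is why the size of the matrix is the
    threshold. *)
Lemma p_triangular_progression n (N : 'M[rat]_n) (x : 'rV_n) (y : 'cV_n) m l c :
    p_triangular N -> (forall i, 0 <= N i i) -> (0 < l)%N -> c != 0 ->
    let g k := (x *m N ^+ k *m y) 0 0 in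
    (forall k, g (m + k.+1 * l)%N = c * g (m + k * l)%N) ->
  (forall k, g (n + k)%N = 0) \/
  exists i, N i i ^+ l = c /\ forall k, g (n + k)%N = N i i ^+ k * g n.
Proof.
move=> Ntri N0 l0 c0 g gl.
have ds0 d : d \in [seq N i i | i : 'I_n] -> 0 <= d by case/imageP=> i _ ->.
have := annihilated_progression ds0 (annihilated_p_triangular x y Ntri) l0 c0 gl.
rewrite size_image card_ord => -[g0|[d [/imageP [i _ ->] ? ?]]].
  by left=> k; rewrite /g g0 ?leq_addr.
by right; exists i.
Qed.

End PTriangular.

(** * Counting nonzero terms in matrix products, and loops of unique paths *)

Section Counting.

Lemma sum_nat_le1_eq (I : finType) (h : I -> nat) i j :
  (\sum_k h k <= 1)%N -> (0 < h i)%N -> (0 < h j)%N -> i = j.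
Proof.
move=> h1 hi hj; apply/eqP; apply: contraTT h1 => ij; rewrite -ltnNge.
rewrite (bigD1 i) //= (bigD1 j) 1?eq_sym //= addnA.
by rewrite (leq_trans _ (leq_addr _ _)) // (@leq_add 1 1).
Qed.

Lemma sum_nat_le1 (I : finType) (h : I -> nat) :
    (forall i, (h i <= 1)%N) ->
    (forall i j, (0 < h i)%N -> (0 < h j)%N -> i = j) ->
  (\sum_k h k <= 1)%N.
Proof.
move=> h1 hinj; have [i hi|h0] := pickP (fun i => 0 < h i)%N.
  rewrite (bigD1 i) //= big1 ?addn0 // => j ji.
  by apply/eqP; rewrite -leqn0 leqNgt; apply: contraNN ji => hj; rewrite (hinj _ _ hi hj).
by rewrite big1 // => i _; apply/eqP; rewrite -leqn0 leqNgt h0.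
Qed.

Lemma mulmx_natE m n p (A : 'M[nat]_(m, n)) (B : 'M_(n, p)) i j :
  (A *m B) i j = (\sum_k A i k * B k j)%N.
Proof. by rewrite mxE. Qed.

Lemma mulmx_nat_ge m n p (A : 'M[nat]_(m, n)) (B : 'M_(n, p)) i k j :
  (A i k * B k j <= (A *m B) i j)%N.
Proof. by rewrite mulmx_natE (bigD1 k) //= leq_addr. Qed.

Lemma mulmx_nat_gt0P m n p (A : 'M[nat]_(m, n)) (B : 'M_(n, p)) i j :
  reflect (exists k, (0 < A i k)%N && (0 < B k j)%N) (0 < (A *m B) i j)%N.
Proof.
apply: (iffP idP) => [|[k]]; last first.
  by rewrite -muln_gt0 => /leq_trans; apply; apply: mulmx_nat_ge.
rewrite lt0n mulmx_natE sum_nat_eq0 => /forallPn [k].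
by rewrite -lt0n muln_gt0; exists k.
Qed.

Variable F : idomainType.

(* [x] is a sum of [m] nonzero terms; nothing is recorded for [m >= 2], where
   cancellations may occur. *)
Definition counted (x : F) (m : nat) :=
  (m = 0%N -> x = 0) /\ (m = 1%N -> x != 0).

Lemma counted_nonzero x : counted x (x != 0).
Proof. by split; case: eqP. Qed.

Lemma countedD x y m n : counted x m -> counted y n -> counted (x + y) (m + n).
Proof.
move=> [x0 x1] [y0 y1]; case: m n x0 x1 y0 y1 => [|[|m]] [|[|n]] // x0 x1 y0 y1.
- by rewrite x0 // y0 // addr0; split.
- by rewrite x0 // add0r; split=> // _; apply: y1.
- by rewrite y0 // addr0; split=> // _; apply: x1.
Qed.

Lemma countedM x y m n : counted x m -> counted y n -> counted (x * y) (m * n).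
Proof.
move=> [x0 x1] [y0 y1]; split.
  move/eqP; rewrite muln_eq0 => /orP [] /eqP; first by move/x0->; rewrite mul0r.
  by move/y0->; rewrite mulr0.
by move/eqP; rewrite muln_eq1 => /andP [/eqP/x1 ? /eqP/y1 ?]; rewrite mulf_neq0.
Qed.

Lemma counted_sum (I : finType) (f : I -> F) (h : I -> nat) :
  (forall i, counted (f i) (h i)) -> counted (\sum_i f i) (\sum_i h i)%N.
Proof.
by move=> fh; apply: (big_rec2 counted) => [|i x m _ xm]; [split | apply: countedD].
Qed.

Lemma counted_sum_eq (I : finType) (f : I -> F) (h : I -> nat) i :
    (forall i, counted (f i) (h i)) -> (\sum_j h j <= 1)%N -> (0 < h i)%N ->
  \sum_j f j = f i.
Proof.
move=> fh h1 hi; rewrite (bigD1 i) //= big1 ?addr0 // => j ji.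
have [f0 _] := fh j; apply: f0; apply/eqP; rewrite -leqn0 leqNgt.
by apply: contraNN ji => hj; rewrite (sum_nat_le1_eq h1 hi hj).
Qed.

Definition counted_mx m n (A : 'M[F]_(m, n)) (A' : 'M[nat]_(m, n)) :=
  forall i j, counted (A i j) (A' i j).

Lemma counted_mulmx m n p (A : 'M_(m, n)) A' (B : 'M_(n, p)) B' :
  counted_mx A A' -> counted_mx B B' -> counted_mx (A *m B) (A' *m B').
Proof.
move=> AA' BB' i j; rewrite mulmx_natE mxE; apply: counted_sum => k.
exact: countedM.
Qed.

Lemma counted_mx1 n : counted_mx (1%:M : 'M_n) 1%:M.
Proof.
move=> i j; rewrite !mxE; case: eqP => _; split=> //= _; exact: oner_neq0.
Qed.

Lemma counted_mx_exp n (A : 'M_n) A' k :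
  counted_mx A A' -> counted_mx (A ^+ k) (A' ^+ k).
Proof.
move=> AA'; elim: k => [|k IH]; first exact: counted_mx1.
by rewrite !exprS; apply: counted_mulmx.
Qed.

Lemma counted_mulmx_eq m n p (A : 'M_(m, n)) A' (B : 'M_(n, p)) B' i k j :
    counted_mx A A' -> counted_mx B B' -> ((A' *m B') i j <= 1)%N ->
    (0 < A' i k)%N -> (0 < B' k j)%N ->
  (A *m B) i j = A i k * B k j.
Proof.
move=> AA' BB'; rewrite mulmx_natE mxE => AB1 Ak Bk.
apply: (counted_sum_eq _ AB1); last by rewrite muln_gt0 Ak.
by move=> l; apply: countedM.
Qed.

(** Staying at [p] already accounts for one path, and the bound leaves room for no other. All
    entries involved are therefore single products, and one more [W] contributes exactly the factor
    [W p p]. *)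
Lemma counted_loop n (a : 'rV[F]_n) a' (W : 'M_n) W' (b : 'cV_n) b' p :
    counted_mx a a' -> counted_mx W W' -> counted_mx b b' ->
    (forall k, ((a' *m W' ^+ k *m b') 0%R 0%R <= 1)%N) ->
    (0 < a' 0%R p)%N -> (0 < W' p p)%N -> (0 < b' p 0%R)%N ->
  W p p != 0 /\
  forall k, (a *m W ^+ k.+1 *m b) 0 0 = W p p * (a *m W ^+ k *m b) 0 0.
Proof.
move=> aa' WW' bb' le1 ap Wp bp.
have Wbp k : (0 < (W' ^+ k *m b') p 0%R)%N.
  elim: k => [|k IH]; first by rewrite mul1mx.
  by rewrite exprS -mulmxE -mulmxA; apply/mulmx_nat_gt0P; exists p; rewrite Wp.
have aWp : (0 < (a' *m W') 0%R p)%N.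
  by apply/mulmx_nat_gt0P; exists p; rewrite ap.
have aWp1 : ((a' *m W') 0%R p <= 1)%N.
  rewrite (leq_trans _ (le1 1%N)) // expr1 (leq_trans _ (mulmx_nat_ge _ _ _ p _)) //.
  by rewrite leq_pmulr.
have Wp1 : (W' p p <= 1)%N.
  by rewrite (leq_trans _ aWp1) // (leq_trans _ (mulmx_nat_ge _ _ _ p _)) // leq_pmull.
split.
  by have [_] := WW' p p; apply; apply/eqP; rewrite eqn_leq Wp1.
move=> k.
have WbW : counted_mx (W ^+ k *m b) (W' ^+ k *m b').
  by apply: counted_mulmx => //; apply: counted_mx_exp.
rewrite exprS -mulmxE -[in LHS]mulmxA -!mulmxA mulmxA.
rewrite (counted_mulmx_eq (counted_mulmx aa' WW') WbW _ aWp (Wbp k)); last first.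
  by rewrite -!mulmxA (mulmxA W') mulmxE -exprS mulmxA le1.
rewrite (counted_mulmx_eq aa' WbW _ ap (Wbp k)); last by rewrite mulmxA le1.
by rewrite (counted_mulmx_eq aa' WW' aWp1 ap Wp) mulrCA mulrA.
Qed.

(* When the total count is positive it equals 1, so for each [i <= N] exactly
   one state [f i] is visited after [i] factors; a repetition of [f] is a loop. *)
Lemma counted_progression n (x : 'rV[F]_n) x' (V : 'M_n) V' (y : 'cV_n) y' :
    counted_mx x x' -> counted_mx V V' -> counted_mx y y' ->
    (forall k, ((x' *m V' ^+ k *m y') 0%R 0%R <= 1)%N) ->
  let g k := (x *m V ^+ k *m y) 0 0 in
  exists m l c, [/\ (0 < l)%N, c != 0 &
    forall k, g (m + k.+1 * l)%N = c * g (m + k * l)%N].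
Proof.
move=> xx' VV' yy' le1 g.
have [[N [nN xVy]]|noN] :=
    classic (exists N, (n <= N)%N /\ (0 < (x' *m V' ^+ N *m y') 0%R 0%R)%N); last first.
  (* All terms from [n] on vanish, so any positive step and nonzero ratio would do. *)
  exists n, 1%N, 1; split=> // [|k]; first exact: oner_neq0.
  have g0 k' : g (n + k')%N = 0.
    have [g0 _] := counted_mulmx (counted_mulmx xx' (counted_mx_exp (n + k') VV')) yy' 0 0.
    apply: g0; apply/eqP; rewrite -leqn0 leqNgt; apply/negP => gpos.
    by apply: noN; exists (n + k')%N; rewrite leq_addr.
  by rewrite !g0 mulr0.
pose on i p := (0 < (x' *m V' ^+ i) 0%R p)%N && (0 < (V' ^+ (N - i) *m y') p 0%R)%N.
have splitN i : (i <= N)%N ->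
    x' *m V' ^+ N *m y' = (x' *m V' ^+ i) *m (V' ^+ (N - i) *m y').
  by move=> iN; rewrite -{1}(subnKC iN) exprD -mulmxE !mulmxA.
have on_inj i p q : (i <= N)%N -> on i p -> on i q -> p = q.
  move=> iN /andP [p1 p2] /andP [q1 q2].
  have := le1 N; rewrite (splitN i iN) mulmx_natE => /sum_nat_le1_eq; apply.
    by rewrite muln_gt0 p1.
  by rewrite muln_gt0 q1.
(* Pigeonhole: the [n + 1] positions 0, ..., n all lie in the path since [n <= N], and there are
   only [n] states. *)
have /fin_all_exists [f fon] (i : 'I_n.+1) : exists p, on i p.
  apply/mulmx_nat_gt0P; rewrite -splitN //.
  by rewrite (leq_trans _ nN) // -ltnS.
have [i [j [ij jN fij]]] : exists i j : 'I_n.+1, [/\ i < j, j <= N & f i = f j]%N.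
  have /injectivePn [i [j]] : ~~ injectiveb f.
    apply/injectiveP => /leq_card; by rewrite !card_ord ltnn.
  have leN (k : 'I_n.+1) : (k <= N)%N by rewrite (leq_trans _ nN) // -ltnS.
  rewrite -val_eqE neq_ltn => /orP [] ij fij; last by exists j, i.
  by exists i, j.
have iN : (i <= N)%N by rewrite ltnW // (leq_trans ij).
move: (fon i) (fon j); rewrite -fij; set p := f i => oni onj.
pose l := (j - i)%N; pose W' := V' ^+ l.
(* From [p] at position [i] the path continues to some [q] at position [j]; uniqueness at [j] forces
   [q = p]. *)
have Wp : (0 < W' p p)%N.
  have /andP [xp] := oni.
  have -> : V' ^+ (N - i) *m y' = W' *m (V' ^+ (N - j) *m y').
    rewrite mulmxA mulmxE -exprD; congr (_ ^+ _ *m _).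
    by rewrite addnC addnBA 1?ltnW // subnK.
  case/mulmx_nat_gt0P=> q /andP [Wpq yq].
  suff qp : q = p by rewrite -{2}qp.
  apply: (on_inj j) => //; rewrite /on yq andbT.
  have -> : x' *m V' ^+ j = (x' *m V' ^+ i) *m W'.
    by rewrite -mulmxA mulmxE -exprD subnKC // ltnW.
  by apply/mulmx_nat_gt0P; exists p; rewrite xp.
(* Stated over any semiring, so as to serve both the values in [F] and the counts in [nat]. *)
have sandwich (R : pzSemiRingType) (X : 'rV[R]_n) (U : 'M_n) (Y : 'cV_n) k :
    X *m U ^+ i *m (U ^+ l) ^+ k *m (U ^+ (N - j) *m Y) =
    X *m U ^+ (i + (N - j) + k * l) *m Y.
  by rewrite addnAC !exprD mulnC exprM -!mulmxE !mulmxA.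
have xi := counted_mulmx xx' (counted_mx_exp i VV').
have yj := counted_mulmx (counted_mx_exp (N - j) VV') yy'.
have := counted_loop xi (counted_mx_exp l VV') yj _ _ Wp _.
case=> [k|||W0 gl]; rewrite ?sandwich //.
- by case/andP: oni.
- by case/andP: onj.
(* The starting exponent is [N - l]: the path with its loop cut out. *)
exists (i + (N - j))%N, l, ((V ^+ l) p p); split=> [|//|k]; first by rewrite subn_gt0.
by rewrite /g -!sandwich gl.
Qed.

End Counting.

(** * Matrices with at most one nonzero entry per row *)

Section Deterministic.
Variable F : fieldType.

Definition functional_mx m n (A : 'M[F]_(m, n)) :=
  forall i j k, A i j != 0 -> A i k != 0 -> j = k.

Lemma functional_mulmx m n p (A : 'M_(m, n)) (B : 'M_(n, p)) :
  functional_mx A -> functional_mx B -> functional_mx (A *m B).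
Proof.
have step i j : (A *m B) i j != 0 -> exists k, A i k != 0 /\ B k j != 0.
  rewrite mxE => AB0; have /existsP [k] : [exists k, A i k * B k j != 0].
    apply: contraNT AB0 => /existsPn AB0; apply/eqP; apply: big1 => k _.
    by apply/eqP; rewrite -[_ == 0]negbK AB0.
  by rewrite mulf_eq0 => /norP; exists k.
move=> Afun Bfun i j k /step [j' [Aj Bj]] /step [k' [Ak Bk]].
by rewrite (Afun _ _ _ Aj Ak) in Bj; apply: Bfun Bj Bk.
Qed.

Lemma functional_mx1 n : functional_mx (1%:M : 'M_n).
Proof.
move=> i j k; rewrite !mxE.
by case: (i =P j) => [<-|] //; case: (i =P k) => // _ _; rewrite eqxx.
Qed.

Lemma functional_mx_exp n (A : 'M_n) k :
  functional_mx A -> functional_mx (A ^+ k).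
Proof.
move=> Afun; elim: k => [|k IH]; first exact: functional_mx1.
by rewrite exprS; apply: functional_mulmx.
Qed.

(** Each vector [x *m V ^+ k] is supported on at most one state, so among [n + 1] of them one
    vanishes or two are collinear. The relation holds between vectors, before any final vector is
    chosen. *)
Lemma functional_progression n (x : 'rV[F]_n) (V : 'M_n) :
    functional_mx x -> functional_mx V ->
  exists m l c, [/\ (0 < l)%N, c != 0 &
    forall k, x *m V ^+ (m + k.+1 * l) = c *: (x *m V ^+ (m + k * l))].
Proof.
move=> xfun Vfun.
(* One collinearity suffices: multiplying it on the right by [V ^+ (k * l)] gives the others. *)
suff [m [l [c [l0 c0 xV]]]] : exists m l c, [/\ (0 < l)%N, c != 0 &
    x *m V ^+ (m + l) = c *: (x *m V ^+ m)].
  exists m, l, c; split=> // k.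
  rewrite mulSn addnA exprD -mulmxE mulmxA xV -scalemxAl -mulmxA.
  by rewrite mulmxE -exprD.
have [k /eqP xVk|xV_neq0] := pickP (fun k : 'I_n.+1 => x *m V ^+ k == 0).
  exists k, 1%N, 1; split=> //; first exact: oner_neq0.
  by rewrite exprD -mulmxE mulmxA xVk mul0mx scaler0.
have /fin_all_exists [f fV] (k : 'I_n.+1) : exists p, (x *m V ^+ k) 0 p != 0.
  by apply/rV0Pn; rewrite xV_neq0.
have [i [j [ij fij]]] : exists i j : 'I_n.+1, (i < j)%N /\ f i = f j.
  have /injectivePn [i [j]] : ~~ injectiveb f.
    by apply/injectiveP => /leq_card; rewrite !card_ord ltnn.
  rewrite -val_eqE neq_ltn => /orP [] ij fij; last by exists j, i.
  by exists i, j.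
pose c := (x *m V ^+ j) 0 (f i) / (x *m V ^+ i) 0 (f i).
exists i, (j - i)%N, c; rewrite subn_gt0 ij subnKC ?(ltnW ij) //; split=> //.
  by rewrite mulf_neq0 ?invr_neq0 // fij.
have xVfun k : functional_mx (x *m V ^+ k).
  by apply: functional_mulmx => //; apply: functional_mx_exp.
have offdiag k p : p != f k -> (x *m V ^+ k) 0 p = 0.
  by move=> pk; apply/eqP; apply: contraNT pk => /(xVfun k _ _ _ (fV k)) ->.
apply/rowP=> p; rewrite [RHS]mxE.
have [->|pi] := eqVneq p (f i); first by rewrite divfK.
by rewrite !offdiag ?mulr0 // -fij.
Qed.

End Deterministic.

(** * Path counts of automata and the two pumping properties *)

Section Words.
Variable Sigma : finType.
Implicit Types (A B : wautomaton Sigma) (u v w : seq Sigma).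

Lemma wa_wordmx_cat A u v :
  wa_wordmx A (u ++ v) = wa_wordmx A u *m wa_wordmx A v.
Proof. exact: big_cat. Qed.

Lemma wa_wordmx_exp A v n : wa_wordmx A (word_exp v n) = wa_wordmx A v ^+ n.
Proof.
elim: n => [|n IH]; first exact: big_nil.
by rewrite /word_exp /= wa_wordmx_cat IH exprS.
Qed.

Lemma wa_val_pump A u v w n :
  wa_val A (u ++ word_exp v n ++ w) =
  ((wa_init A)^T *m wa_wordmx A u *m wa_wordmx A v ^+ n *m
    (wa_wordmx A w *m wa_final A)) 0 0.
Proof. by rewrite /wa_val !wa_wordmx_cat wa_wordmx_exp !mulmxA. Qed.

Lemma wa_wordmx_ge0 A w p q : nonneg_transitions A -> 0 <= wa_wordmx A w p q.
Proof.
move=> A0; elim: w p q => [|a w IH] p q.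
  by rewrite /wa_wordmx big_nil mxE; case: (p == q); rewrite ?ler01.
rewrite /wa_wordmx big_cons mxE; apply: sumr_ge0 => r _; exact: mulr_ge0.
Qed.

Lemma wa_wordmx_functional A w : deterministic A -> functional_mx (wa_wordmx A w).
Proof.
case=> _ Adet; elim: w => [|a w IH].
  by rewrite /wa_wordmx big_nil; apply: functional_mx1.
by rewrite /wa_wordmx big_cons; apply: functional_mulmx => // i j k; apply: Adet.
Qed.

Definition support_mx m n (A : 'M[rat]_(m, n)) : 'M[nat]_(m, n) :=
  map_mx (fun x => nat_of_bool (x != 0)) A.

Lemma support_mxE m n (A : 'M_(m, n)) i j : support_mx A i j = (A i j != 0).
Proof. exact: mxE. Qed.

Lemma counted_support m n (A : 'M_(m, n)) : counted_mx A (support_mx A).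
Proof. by move=> i j; rewrite mxE; apply: counted_nonzero. Qed.

(** The entry at (p, q) is the number of paths on [w] from p to q; working in [nat] excludes
    cancellation. *)
Definition path_count A w : 'M[nat]_(wa_size A) :=
  \prod_(a <- w) support_mx (wa_mx A a).

Lemma path_count_cat A u v :
  path_count A (u ++ v) = path_count A u *m path_count A v.
Proof. exact: big_cat. Qed.

Lemma path_count_exp A v n : path_count A (word_exp v n) = path_count A v ^+ n.
Proof.
elim: n => [|n IH]; first exact: big_nil.
by rewrite /word_exp /= path_count_cat IH exprS.
Qed.

Lemma counted_wordmx A w : counted_mx (wa_wordmx A w) (path_count A w).
Proof.
rewrite /wa_wordmx /path_count; elim: w => [|a w IH].
  by rewrite !big_nil; apply: counted_mx1.
by rewrite !big_cons; apply: counted_mulmx => //; apply: counted_support.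
Qed.

(** A run without its initial condition, with the first state split off so that induction on [w] can
    change it. *)
Definition accepting A w (p : 'I_(wa_size A)) s :=
  is_path w (p :: s) && (wa_final A (last p s) 0 != 0).

Definition accepting_count A w := path_count A w *m support_mx (wa_final A).

Lemma accepting_count_nil A : accepting_count A [::] = support_mx (wa_final A).
Proof. by rewrite /accepting_count /path_count big_nil mul1mx. Qed.

Lemma accepting_count_cons A a w :
  accepting_count A (a :: w) = support_mx (wa_mx A a) *m accepting_count A w.
Proof. by rewrite /accepting_count /path_count big_cons -mulmxE mulmxA. Qed.

Lemma accepting_cons A a w p q s :
  accepting (A := A) (a :: w) p (q :: s) =
  (wa_mx A a p q != 0) && accepting w q s.
Proof. by rewrite /accepting /= andbA. Qed.

Lemma accepting_count_gt0 A w p :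
  (0 < accepting_count A w p 0%R)%N -> exists s, accepting w p s.
Proof.
elim: w p => [|a w IH] p.
  by rewrite accepting_count_nil mxE lt0b; exists [::].
rewrite accepting_count_cons => /mulmx_nat_gt0P [q /andP []].
rewrite mxE lt0b => pq /IH [s qs].
by exists (q :: s); rewrite accepting_cons pq.
Qed.

Lemma accepting_count_le1 A w p :
    (forall s s', accepting w p s -> accepting w p s' -> s = s') ->
  (accepting_count A w p 0%R <= 1)%N.
Proof.
elim: w p => [|a w IH] p p_uniq.
  by rewrite accepting_count_nil mxE; case: (_ != _).
rewrite accepting_count_cons mulmx_natE; apply: sum_nat_le1 => [q|q q'].
  rewrite mxE; have [//|pq] := eqVneq; rewrite mul1n; apply: IH => s s' qs qs'.
  suff [] : q :: s = q :: s' by [].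
  by apply: p_uniq; rewrite accepting_cons pq.
rewrite !muln_gt0 !support_mxE !lt0b => /andP [pq /accepting_count_gt0 [s qs]].
move=> /andP [pq' /accepting_count_gt0 [s' qs']].
suff [] : q :: s = q' :: s' by [].
by apply: p_uniq; rewrite accepting_cons ?pq ?pq'.
Qed.

(** The entry counts the runs on [w]; this turns unambiguity into the bound required by
    [counted_progression]. *)
Lemma run_count_le1 A w : unambiguous A ->
  (((support_mx (wa_init A))^T *m accepting_count A w) 0%R 0%R <= 1)%N.
Proof.
move=> Aunamb.
have run p s : accepting w p s -> wa_init A p 0 != 0 -> is_run w (p :: s).
  by rewrite /is_run => /andP [-> ->] ->.
rewrite mulmx_natE; apply: sum_nat_le1 => [p|p p'].
  rewrite [_^T _ _]mxE support_mxE; have [//|p0] := eqVneq; rewrite mul1n.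
  apply: accepting_count_le1 => s s' ps ps'.
  by have [] := Aunamb _ _ _ (run _ _ ps p0) (run _ _ ps' p0).
rewrite !muln_gt0 ![_^T _ _]mxE !support_mxE !lt0b => /andP [p0 /accepting_count_gt0 [s ps]].
move=> /andP [p'0 /accepting_count_gt0 [s' ps']].
by have [] := Aunamb _ _ _ (run _ _ ps p0) (run _ _ ps' p'0).
Qed.

Lemma unambiguous_progression A u v w : unambiguous A ->
  let g n := wa_val A (u ++ word_exp v n ++ w) in
  exists m l c, [/\ (0 < l)%N, c != 0 &
    forall k, g (m + k.+1 * l)%N = c * g (m + k * l)%N].
Proof.
move=> Aunamb g.
have init : counted_mx ((wa_init A)^T *m wa_wordmx A u)
    ((support_mx (wa_init A))^T *m path_count A u).
  apply: counted_mulmx (counted_wordmx u) => i j.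
  by rewrite !mxE; apply: counted_nonzero.
have final := counted_mulmx (counted_wordmx w) (counted_support (wa_final A)).
have := counted_progression init (counted_wordmx v) final.
case=> [k|m [l [c [l0 c0 gl]]]].
  have := run_count_le1 (u ++ word_exp v k ++ w) Aunamb.
  by rewrite /accepting_count !path_count_cat path_count_exp !mulmxA.
by exists m, l, c; split=> // k; rewrite /g !wa_val_pump gl.
Qed.

Lemma deterministic_progression A u v : deterministic A ->
  exists m l c, [/\ (0 < l)%N, c != 0 & forall w k,
    wa_val A (u ++ word_exp v (m + k.+1 * l) ++ w) =
    c * wa_val A (u ++ word_exp v (m + k * l) ++ w)].
Proof.
move=> Adet; have [Ainit _] := Adet.
have init : functional_mx ((wa_init A)^T *m wa_wordmx A u).
  apply: functional_mulmx (@wa_wordmx_functional A u Adet) => i p q.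
  by rewrite !mxE ord1; apply: Ainit.
have [m [l [c [l0 c0 xV]]]] :=
  functional_progression init (@wa_wordmx_functional A v Adet).
exists m, l, c; split=> // w k.
by rewrite !wa_val_pump xV -scalemxAl [LHS]mxE.
Qed.

Lemma unambiguisable_pumpable A :
  nonneg_transitions A -> unambiguisable A -> pumpable A.
Proof.
move=> A0 [B [AB Bunamb]] u v w vtri.
have [m [l [c [l0 c0 gl]]]] := unambiguous_progression u v w Bunamb.
have diag0 q : 0 <= wa_wordmx A v q q by apply: wa_wordmx_ge0.
have := @p_triangular_progression _ _ ((wa_init A)^T *m wa_wordmx A u)
  (wa_wordmx A w *m wa_final A) m l c vtri diag0 l0 c0.
case=> [k|g0|[q [_ gq]]]; first by rewrite -!wa_val_pump !AB gl.
  exists (Ordinal (wa_size_gt0 A)) => n.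
  by rewrite !wa_val_pump g0; have := g0 0%N; rewrite addn0 => ->; rewrite mulr0.
by exists q => n; rewrite !wa_val_pump gq.
Qed.

Lemma determinisable_blindly_pumpable A :
  nonneg_transitions A -> determinisable A -> blindly_pumpable A.
Proof.
move=> A0 [B [AB Bdet]] u v vtri.
have [m [l [c [l0 c0 gl]]]] := deterministic_progression u v Bdet.
have diag0 q : 0 <= wa_wordmx A v q q by apply: wa_wordmx_ge0.
have prog w := @p_triangular_progression _ _ ((wa_init A)^T *m wa_wordmx A u)
  (wa_wordmx A w *m wa_final A) m l c vtri diag0 l0 c0.
have {}prog w : (forall n, wa_val A (u ++ word_exp v (wa_size A + n) ++ w) = 0) \/
    exists q, wa_wordmx A v q q ^+ l = c /\ forall n,
      wa_val A (u ++ word_exp v (wa_size A + n) ++ w) =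
      wa_wordmx A v q q ^+ n * wa_val A (u ++ word_exp v (wa_size A) ++ w).
  case: (prog w) => [k|g0|[q [qc gq]]]; first by rewrite -!wa_val_pump !AB gl.
    by left=> n; rewrite wa_val_pump g0.
  by right; exists q; split=> // n; rewrite !wa_val_pump gq.
have [q /eqP qc|noq] := pickP (fun q => wa_wordmx A v q q ^+ l == c).
  exists q => w n; case: (prog w) => [g0|[q' [q'c ->]]].
    by rewrite g0; have := g0 0%N; rewrite addn0 => ->; rewrite mulr0.
  suff -> : wa_wordmx A v q q = wa_wordmx A v q' q' by [].
  by apply/eqP; rewrite -(eqrXn2 l0) // qc q'c.
exists (Ordinal (wa_size_gt0 A)) => w n.
case: (prog w) => [g0|[q [/eqP]]]; last by rewrite noq.
by rewrite g0; have := g0 0%N; rewrite addn0 => ->; rewrite mulr0.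
Qed.

End Words.

Theorem proposition10 (Sigma : finType) (A : wautomaton Sigma)
    (hint : integral A) (hnonneg : nonneg_transitions A) (htrim : trim A) :
  (unambiguisable A -> pumpable A) /\ (determinisable A -> blindly_pumpable A).
Proof.
by split; [apply: unambiguisable_pumpable | apply: determinisable_blindly_pumpable].
Qed.
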